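(* Let $\mathcal E$ be a nest on a complex Banach space $X$ having the $p_\infty$-property and let $\Psi$ be a support function on $\mathcal E$ with $\Psi(\{0\})=\{0\}$. Then the support function and the essential support function of the $\mathcal T(\mathcal E)$-bimodule $\mathcal M^0(\Psi)$ both equal $\Psi_-$: $\Phi_{\mathcal M^0(\Psi)}=\Psi_-=\Phi^e_{\mathcal M^0(\Psi)}$.
   Context: A nest $\mathcal E$ on $X$ is a family of closed linear subspaces of $X$, totally ordered by inclusion, containing $\{0\}$ and $X$, closed under arbitrary meets $\wedge$ (intersections) and joins $\vee$ (norm-closed linear spans of unions). For $E\in\mathcal E$, $E_-=\vee\{F\in\mathcal E: F\subsetneq E\}$ and $E_+=\wedge\{F\in\mathcal E: E\subsetneq F\}$. For subspaces $M,L$ ($L$ closed), $M/L=\{m+L:m\in M\}$ and $\dim(M/L)$ its dimension. $\mathcal E$ has the $p_\infty$-property if $\dim(N/N_-)=\infty$ for every $N\in\mathcal E$ with $N_-\subsetneq N$ (under this property every support function is an essential support function). A support function is an inclusion-preserving map $\Psi:\mathcal E\to\mathcal E$; $\Psi_-$ is defined by $\Psi_-(\{0\})=\Psi(\{0\})$ and, for $E\neq\{0\}$, $\Psi_-(E)=\Psi(E)$ if $E_-\subsetneq E$, $\Psi_-(E)=\vee_{F\in\mathcal E,F\subsetneq E}\Psi(F)$ if $E_-=E$. $\mathcal T(\mathcal E)=\{T\in\mathcal B(X): TE\subseteq E\ \forall E\}$. $\mathcal M^0(\Psi)$ is the norm closure of $\sum_{L,N\in\mathcal E,\ L_-\subsetneq\Psi(N)}\operatorname{span}\{f\otimes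 x: f\in(N_-)^\perp, x\in L\}$, where $S^\perp=\{f\in X^*:f(S)=\{0\}\}$ and $f\otimes x$ is $y\mapsto f(y)x$. For a bimodule $\mathcal J$, $\Phi_{\mathcal J}(E)=[\mathcal JE]$ (norm-closed linear span of $\{Tx:T\in\mathcal J,x\in E\}$) and $\Phi^e_{\mathcal J}(N)=\wedge\{L\in\mathcal E:\dim(TN/L)<\infty\ \forall T\in\mathcal J\}$. *)

(* Defs.v *)
From HB Require Import structures.
From mathcomp Require Import all_boot all_order all_algebra.
From mathcomp Require Import all_classical all_reals all_analysis.
From mathcomp Require Import complex.
Import Order.TTheory GRing.Theory Num.Theory.
Import numFieldNormedType.Exports.

Set Implicit Arguments.
Unset Strict Implicit.
Unset Printing Implicit Defensive.

Local Open Scope classical_set_scope.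
Local Open Scope ring_scope.

Section NestDefs.
Variable R : realType.
Local Notation C := (R[i]).
Variable X : completeNormedModType C.

Definition is_subspace (M : set X) : Prop :=
  M 0 /\ forall (a : C) (x y : X), M x -> M y -> M (a *: x + y).

Definition closed_subspace (M : set X) : Prop := is_subspace M /\ closed M.

Definition lin_span (S : set X) : set X :=
  [set x | exists (n : nat) (c : 'I_n -> C) (v : 'I_n -> X),
      (forall i, S (v i)) /\ x = \sum_(i < n) c i *: v i].

Definition cspan (S : set X) : set X := closure (lin_span S).

Definition nest (E : set (set X)) : Prop :=
  (forall M, E M -> closed_subspace M) /\
  (forall M N, E M -> E N -> M `<=` N \/ N `<=` M) /\
  E [set 0] /\ E setT /\
  (forall F, F `<=` E -> E (\bigcap_(M in F) M)) /\
  (forall F, F `<=` E -> E (cspan (\bigcup_(M in F) M))).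

Definition sproper (A B : set X) : Prop := A `<=` B /\ A <> B.

Definition Eminus (E : set (set X)) (M : set X) : set X :=
  cspan (\bigcup_(F in [set F | E F /\ sproper F M]) F).

Definition findim_quot (M L : set X) : Prop :=
  exists (n : nat) (v : 'I_n -> X), forall m, M m ->
    exists c : 'I_n -> C, L (m - \sum_(i < n) c i *: v i).

Definition p_infty (E : set (set X)) : Prop :=
  forall N, E N -> sproper (Eminus E N) N -> ~ findim_quot N (Eminus E N).

Definition support_function (E : set (set X)) (Psi : set X -> set X) : Prop :=
  (forall M, E M -> E (Psi M)) /\
  (forall M N, E M -> E N -> M `<=` N -> Psi M `<=` Psi N).

Definition Psi_minus (E : set (set X)) (Psi : set X -> set X) (M : set X)
  : set X :=
  if `[< M = [set 0] >] then Psi M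
  else if `[< sproper (Eminus E M) M >] then Psi M
  else cspan (\bigcup_(F in [set F | E F /\ sproper F M]) Psi F).

Definition bounded_op (T : X -> X) : Prop :=
  (forall (a : C) (x y : X), T (a *: x + y) = a *: T x + T y) /\ continuous T.

Definition dual_elt (f : X -> C^o) : Prop :=
  (forall (a : C) (x y : X), f (a *: x + y) = a * f x + f y) /\ continuous f.

Definition annihilator (S : set X) : set (X -> C^o) :=
  [set f | dual_elt f /\ forall x, S x -> f x = 0].

Definition nest_algebra (E : set (set X)) : set (X -> X) :=
  [set T | bounded_op T /\ forall M, E M -> T @` M `<=` M].

Definition rank_one (f : X -> C^o) (x : X) : X -> X := fun y => f y *: x.

Definition op_closure (S : set (X -> X)) : set (X -> X) :=
  [set T | bounded_op T /\ forall eps : R, 0 < eps ->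
     exists2 U, S U & forall y : X, `|T y - U y| <= (eps%:C)%C * `|y|].

Definition M0_gen (E : set (set X)) (Psi : set X -> set X) : set (X -> X) :=
  [set T | exists (n : nat) (c : 'I_n -> C) (f : 'I_n -> X -> C^o)
     (x : 'I_n -> X) (L N : 'I_n -> set X),
     (forall i, [/\ E (L i), E (N i), sproper (Eminus E (L i)) (Psi (N i)),
                    annihilator (Eminus E (N i)) (f i) & L i (x i)]) /\
     T = fun y => \sum_(i < n) c i *: rank_one (f i) (x i) y].

Definition M0 (E : set (set X)) (Psi : set X -> set X) : set (X -> X) :=
  op_closure (M0_gen E Psi).

Definition Phi (J : set (X -> X)) (M : set X) : set X :=
  cspan [set z | exists T x, J T /\ M x /\ z = T x].

Definition Phi_e (E : set (set X)) (J : set (X -> X)) (N : set X) : set X :=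
  \bigcap_(L in [set L | E L /\ forall T, J T -> findim_quot (T @` N) L]) L.

End NestDefs.

(* Main.v *)
Require Import Defs.
From HB Require Import structures.
From mathcomp Require Import all_boot all_order all_algebra.
From mathcomp Require Import all_classical all_reals all_analysis.
From mathcomp Require Import complex.
From mathcomp Require Import lra ring.
Import Order.TTheory GRing.Theory Num.Theory.
Import numFieldNormedType.Exports.
Set Implicit Arguments.
Unset Strict Implicit.
Unset Printing Implicit Defensive.
Local Open Scope classical_set_scope.
Local Open Scope ring_scope.

(* Every operator of M0(Psi) maps N into Psi_-(N), because L_- properly contained
   in Psi(N') forces L to lie in Psi(N'), while f in (N'_-)^perp vanishes on N
   unless N'_- is properly contained in N. This gives Phi(N) and Phi^e(N) inside
   Psi_-(N).

   For the reverse inclusions it is enough to reach Psi(F) for F in E with F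
   inside N and N not inside F_-. Hahn-Banach gives f in F_-^perp with f(y) = 1
   for some y in N, so the operators f (x) x with x in some L, L_- properly
   contained in Psi(F), show Psi(F) inside Phi(N).  If K in E is properly
   contained in Psi(F), then the union of those subspaces L is
   infinite-dimensional modulo K, and N is infinite-dimensional modulo F_-. An
   absolutely convergent series of rank one operators, triangular with respect
   to flags in these two quotients, is then an operator T of M0(Psi) for which
   T N is infinite-dimensional modulo K. *)

(** * Sublinear functionals and the real Hahn-Banach theorem *)

Section SublinearFunctionals.
Variables (R : realType) (V : lmodType R[i]).
Implicit Types (p q : V -> R) (x y z : V).

Definition sublinear q :=
  (forall x y, q (x + y) <= q x + q y) /\
  (forall (t : R) x, 0 <= t -> q ((t%:C)%C *: x) = t * q x).

Lemma real_scaleA (s t : R) x :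
  (s%:C)%C *: ((t%:C)%C *: x) = ((s * t)%:C)%C *: x.
Proof. by rewrite scalerA rmorphM. Qed.

Lemma real_scaleDl (s t : R) x :
  ((s + t)%:C)%C *: x = (s%:C)%C *: x + (t%:C)%C *: x.
Proof. by rewrite rmorphD scalerDl. Qed.

Lemma sublinear0 q : sublinear q -> q 0 = 0.
Proof. by move=> [_ qZ]; have := qZ 0 0 (lexx _); rewrite scaler0 mul0r. Qed.

Lemma sublinear_ge_opp q x : sublinear q -> - q (- x) <= q x.
Proof.
move=> qs; have := qs.1 x (- x); rewrite subrr sublinear0 //.
by move=> h; rewrite lerNl -subr_ge0 opprK addrC.
Qed.

Definition shift_set q z x : set R :=
  [set r | exists2 t, 0 <= t & r = q (x + (t%:C)%C *: z) - t * q z].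

(* The largest sublinear functional below q whose value at - z is at most - q z;
   comparing it with a minimal q shows that q is odd, hence linear. *)
Definition shift q z x : R := inf (shift_set q z x).

(** Subadditivity for [x + t z] and [- x] gives [t q(z) <= q(x + t z) + q(- x)]. The bound is
    uniform in [t], so the infimum defining [shift] is a genuine one. *)
Lemma shift_lbound q z x : sublinear q -> lbound (shift_set q z x) (- q (- x)).
Proof.
move=> [qD qZ] _ [t t0 ->].
have := qD (x + (t%:C)%C *: z) (- x).
by rewrite addrAC subrr add0r qZ //; lra.
Qed.

Lemma shift_le_at q z x (t : R) : sublinear q -> 0 <= t ->
  shift q z x <= q (x + (t%:C)%C *: z) - t * q z.
Proof.
move=> qs t0; apply: ge_inf; last by exists t.
by exists (- q (- x)); apply: shift_lbound.
Qed.

Lemma le_shift q z x a :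
  (forall t, 0 <= t -> a <= q (x + (t%:C)%C *: z) - t * q z) ->
  a <= shift q z x.
Proof.
move=> h; apply: lb_le_inf; last by move=> _ [t t0 ->]; exact: h.
by exists (q (x + (0%:C)%C *: z) - 0 * q z); exists 0.
Qed.

Lemma shift_le q z x : sublinear q -> shift q z x <= q x.
Proof.
move=> qs; have := @shift_le_at q z x 0 qs (lexx _).
by rewrite scale0r addr0 mul0r subr0.
Qed.

Lemma shift_opp q z : sublinear q -> shift q z (- z) <= - q z.
Proof.
move=> qs; have := @shift_le_at q z (- z) 1 qs ler01.
by rewrite scale1r addNr sublinear0 // mul1r sub0r.
Qed.

Lemma sublinear_shift q z : sublinear q -> sublinear (shift q z).
Proof.
move=> qs; have [qD qZ] := qs; split=> [x y|].
  rewrite -lerBlDr; apply: le_shift => s s0.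
  rewrite lerBlDr [leRHS]addrC -lerBlDr; apply: le_shift => t t0.
  (* Parameters [s] for [x] and [t] for [y] combine into the admissible parameter [s + t] for
     [x + y]. *)
  have := @shift_le_at q z (x + y) (s + t) qs (addr_ge0 s0 t0).
  have := qD (x + (s%:C)%C *: z) (y + (t%:C)%C *: z).
  by rewrite addrACA -real_scaleDl; lra.
have shiftZ_le s x : 0 < s -> shift q z ((s%:C)%C *: x) <= s * shift q z x.
  move=> s0; rewrite mulrC -ler_pdivrMr //.
  apply: le_shift => t t0; rewrite ler_pdivrMr //.
  apply: le_trans (@shift_le_at q z _ (s * t) qs (mulr_ge0 (ltW s0) t0)) _.
  by rewrite -real_scaleA -scalerDr qZ ?(ltW s0) //; lra.
move=> s x; rewrite le_eqVlt => /orP[/eqP <-|s0].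
  rewrite scale0r mul0r; apply/eqP; rewrite eq_le; apply/andP; split.
    by rewrite -[leRHS](sublinear0 qs); apply: shift_le.
  by apply: le_shift => t t0; rewrite add0r qZ //; lra.
apply/eqP; rewrite eq_le shiftZ_le //=.
have := shiftZ_le s^-1 ((s%:C)%C *: x); rewrite invr_gt0 => /(_ s0).
by rewrite real_scaleA mulVf ?gt_eqF // scale1r mulrC -ler_pdivrMr ?invr_gt0 // invrK mulrC.
Qed.

(** Zorn's lemma for the reversed pointwise order. The pointwise infimum of a chain is finite
    because every member dominates [- p (- x)], and it is subadditive because any two members of the
    chain are comparable. *)
Lemma minimal_sublinear p : sublinear p -> exists q, [/\ sublinear q,
  (forall x, q x <= p x) &
  forall q', sublinear q' -> (forall x, q' x <= q x) -> q' = q].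
Proof.
move=> ps.
pose T := {q | sublinear q /\ forall x, q x <= p x}.
pose r (s t : T) := `[< forall x, sval t x <= sval s x >].
have [||||t tmax] := @Zorn T r.
- by move=> t; apply/asboolP.
- move=> a b c /asboolP ab /asboolP bc; apply/asboolP => x.
  exact: le_trans (bc x) (ab x).
- move=> [a Ha] [b Hb] /asboolP /= ab /asboolP /= ba; apply: eq_exist.
  by apply/funext => x; apply/eqP; rewrite eq_le ba ab.
- move=> A Atot.
  have [[t0 At0]|nA] := pselect (exists t, A t); last first.
    (* The empty chain is bounded by [p] itself. *)
    exists (exist _ p (conj ps (fun=> lexx _))) => s As.
    by case: nA; exists s.
  pose B x := [set v | exists2 t, A t & v = sval t x].
  pose m x := inf (B x).
  have lb x : lbound (B x) (- p (- x)).
    move=> _ [[q [qs qp]] _ ->] /=.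
    apply: le_trans _ (sublinear_ge_opp x qs).
    by rewrite lerN2 qp.
  have mle x t : A t -> m x <= sval t x.
    move=> At; apply: ge_inf; last by exists t.
    by exists (- p (- x)).
  have lem x a : (forall t, A t -> a <= sval t x) -> a <= m x.
    move=> h; apply: lb_le_inf; last by move=> _ [t At ->]; exact: h.
    by exists (sval t0 x); exists t0.
  have ms : sublinear m.
    split=> [x y|s x s0].
      rewrite -lerBlDr; apply: (lem) => s As.
      rewrite lerBlDr [leRHS]addrC -lerBlDr; apply: (lem) => t At.
      rewrite lerBlDr.
      have [/asboolP st|/asboolP ts] := Atot s t As At.
        apply: le_trans (mle _ t At) _.
        apply: le_trans ((svalP t).1.1 x y) _.
        by rewrite [leRHS]addrC lerD2r.
      apply: le_trans (mle _ s As) _.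
      apply: le_trans ((svalP s).1.1 x y) _.
      by rewrite [leRHS]addrC lerD2l.
    move: s0; rewrite le_eqVlt => /orP[/eqP <-|s0].
      rewrite scale0r mul0r; apply/eqP; rewrite eq_le; apply/andP; split.
        by rewrite -[leRHS](sublinear0 (svalP t0).1); exact: mle.
      by apply: (lem) => t At; rewrite (sublinear0 (svalP t).1).
    apply/eqP; rewrite eq_le; apply/andP; split.
      rewrite mulrC -ler_pdivrMr //; apply: (lem) => t At.
      rewrite ler_pdivrMr // mulrC -(svalP t).1.2 ?(ltW s0) //.
      exact: mle.
    apply: (lem) => t At; rewrite (svalP t).1.2 ?(ltW s0) //.
    by rewrite ler_pM2l //; exact: mle.
  have mp x : m x <= p x by apply: le_trans (mle _ t0 At0) ((svalP t0).2 x).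
  exists (exist _ m (conj ms mp)) => s As; apply/asboolP => x /=.
  exact: mle.
exists (sval t); have [ts tp] := svalP t; split=> // q' q's q't.
have q'p x : q' x <= p x by apply: le_trans (q't x) (tp x).
have /= <- // := tmax (exist _ q' (conj q's q'p)).
exact/asboolP.
Qed.

(** Take [u] minimal below [shift p z]. Minimality forces [shift u x = u] for every [x], hence
    [u (- x) <= - u x]; so [u] is odd, and an odd sublinear functional is linear. Starting from
    [shift p z] rather than [p] secures [u z = p z]. *)
Lemma hahn_banach_sublinear p z : sublinear p -> exists u : V -> R,
  [/\ (forall x y, u (x + y) = u x + u y),
      (forall (t : R) x, u ((t%:C)%C *: x) = t * u x),
      (forall x, u x <= p x) & u z = p z].
Proof.
move=> ps; have [u [us up umin]] := minimal_sublinear (sublinear_shift z ps).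
have uN x : u (- x) = - u x.
  apply/eqP; rewrite eq_le; apply/andP; split.
    rewrite -{1}(umin _ (sublinear_shift x us)); first exact: shift_opp.
    by move=> y; exact: shift_le.
  by rewrite lerNl; exact: sublinear_ge_opp.
have uD x y : u (x + y) = u x + u y.
  apply/eqP; rewrite eq_le us.1 /=.
  have := us.1 (x + y) (- y); rewrite addrK uN; lra.
have ule x : u x <= p x by apply: le_trans (up x) (shift_le z x ps).
exists u; split=> //.
  move=> t x; have [t0|t0] := leP 0 t; first exact: us.2.
  by rewrite -[t]opprK rmorphN scaleNr uN us.2 ?oppr_ge0 ?ltW // -mulNr.
apply/eqP; rewrite eq_le ule /=.
have := up (- z); rewrite uN => h.
by have := le_trans h (shift_opp z ps); rewrite lerN2.
Qed.

End SublinearFunctionals.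

(** * Real-valued norms on complex normed spaces *)

Section RealNorm.
Variable R : realType.

(** The norm of a space over [R[i]] takes values in [R[i]]. Its real part carries the same
    information and lives in the ordered field [R], where infima and linear arithmetic are
    available. *)
Definition rnorm (V : normedZmodType R[i]) (x : V) : R := complex.Re `|x|.

Lemma rnormE (V : normedZmodType R[i]) (x : V) : `|x| = ((rnorm x)%:C)%C.
Proof. by rewrite /rnorm RRe_real // normr_real. Qed.

Lemma rnorm_ge0 (V : normedZmodType R[i]) (x : V) : 0 <= rnorm x.
Proof. by rewrite -ler0c -rnormE. Qed.

Lemma rnorm0 (V : normedZmodType R[i]) : rnorm (0 : V) = 0.
Proof. by rewrite /rnorm normr0. Qed.

Lemma rnormN (V : normedZmodType R[i]) (x : V) : rnorm (- x) = rnorm x.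
Proof. by rewrite /rnorm normrN. Qed.

Lemma rnormB (V : normedZmodType R[i]) (x y : V) : rnorm (x - y) = rnorm (y - x).
Proof. by rewrite -opprB rnormN. Qed.

Lemma rnormD (V : normedZmodType R[i]) (x y : V) :
  rnorm (x + y) <= rnorm x + rnorm y.
Proof. by have := ler_normD x y; rewrite !rnormE -rmorphD lecR. Qed.

Lemma rnormZ (V : normedModType R[i]) (a : R[i]) (x : V) :
  rnorm (a *: x) = rnorm a * rnorm x.
Proof.
by have := normrZ a x; rewrite !rnormE -rmorphM => /complexI.
Qed.

Lemma rnorm_real (t : R) : rnorm (t%:C)%C = `|t|.
Proof. by rewrite /rnorm normc_def /= expr0n addr0 sqrtr_sqr. Qed.

Lemma rnorm_eq0 (V : normedModType R[i]) (x : V) : rnorm x = 0 -> x = 0.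
Proof. by move=> x0; apply/eqP; rewrite -normr_eq0 rnormE x0. Qed.

Lemma gt0_complexE (e : R[i]) : 0 < e -> exists2 r : R, 0 < r & e = (r%:C)%C.
Proof.
move=> e0; exists (complex.Re e); last by rewrite RRe_real // gtr0_real.
by move: e0; rewrite ltcE => /andP[].
Qed.

Lemma closure_rnormP (V : normedModType R[i]) (A : set V) (x : V) :
  closure A x <-> forall e : R, 0 < e -> exists2 a, A a & rnorm (x - a) < e.
Proof.
split=> [clAx e e0|h B].
  have [|a [Aa xa]] := clAx (ball x (e%:C)%C).
    by apply: nbhsx_ballx; rewrite ltcR.
  exists a => //; move: xa; rewrite -ball_normE /= rnormE.
  by rewrite ltcR.
rewrite -nbhs_ballE => -[e /= /gt0_complexE[r r0 ->] eB].
have [a Aa xa] := h r r0; exists a; split=> //; apply: eB.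
by rewrite -ball_normE /= rnormE ltcR.
Qed.

Lemma lipschitz_continuous (V W : normedModType R[i]) (f : V -> W) (B : R) :
  (forall x y, rnorm (f x - f y) <= B * rnorm (x - y)) -> continuous f.
Proof.
move=> fB x; apply/cvgrPdist_lt => _ /gt0_complexE[e e0 ->].
(* The sign of [B] is unknown, so [1 + |B|] serves as a positive Lipschitz constant. *)
have B0 : 0 < 1 + `|B| by rewrite ltr_pwDl.
have d0 : 0 < e / (1 + `|B|) by rewrite divr_gt0.
apply/nbhs_normP; exists (((e / (1 + `|B|))%:C)%C) => /=.
  by rewrite ltcR.
move=> y /=; rewrite !rnormE !ltcR ltr_pdivlMr // => xy.
apply: le_lt_trans xy; apply: le_trans (fB x y) _.
rewrite mulrC ler_wpM2l ?rnorm_ge0 //.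
by apply: le_trans (ler_norm B) _; rewrite lerDr.
Qed.

End RealNorm.

(** * Quotient seminorms and separation of a point from a closed subspace *)

Section Separation.
Variables (R : realType) (X : completeNormedModType R[i]).
Implicit Types (M : set X) (x y z : X).

Lemma subspaceD M x y : is_subspace M -> M x -> M y -> M (x + y).
Proof. by move=> [_ h] Mx My; have := h 1 x y Mx My; rewrite scale1r. Qed.

Lemma subspaceZ M a x : is_subspace M -> M x -> M (a *: x).
Proof. by move=> [M0 h] Mx; have := h a x 0 Mx M0; rewrite addr0. Qed.

Lemma subspaceB M x y : is_subspace M -> M x -> M y -> M (x - y).
Proof.
move=> Ms Mx My; apply: subspaceD => //.
by rewrite -scaleN1r; exact: subspaceZ.
Qed.

Lemma subspace_sum M (I : Type) (r : seq I) (P : pred I) (F : I -> X) :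
  is_subspace M -> (forall i, P i -> M (F i)) -> M (\sum_(i <- r | P i) F i).
Proof.
move=> Ms MF; apply: (big_ind M) => //; first exact: Ms.1.
by move=> x y; exact: subspaceD.
Qed.

Definition quotient_norm M x : R := inf [set r | exists2 m, M m & r = rnorm (x - m)].

Lemma quotient_norm_le M x m : M m -> quotient_norm M x <= rnorm (x - m).
Proof.
move=> Mm; apply: ge_inf; last by exists m.
by exists 0 => _ [m' _ ->]; exact: rnorm_ge0.
Qed.

Lemma le_quotient_norm M x a : is_subspace M ->
  (forall m, M m -> a <= rnorm (x - m)) -> a <= quotient_norm M x.
Proof.
move=> Ms h; apply: lb_le_inf; last by move=> _ [m Mm ->]; exact: h.
by exists (rnorm (x - 0)); exists 0 => //; exact: Ms.1.
Qed.

Lemma sublinear_quotient_norm M : is_subspace M -> sublinear (quotient_norm M).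
Proof.
move=> Ms; split=> [x y|].
  rewrite -lerBlDr; apply: le_quotient_norm => // m Mm.
  rewrite lerBlDr [leRHS]addrC -lerBlDr; apply: le_quotient_norm => // n Mn.
  rewrite lerBlDr [leRHS]addrC; apply: le_trans (rnormD _ _).
  rewrite addrACA -opprD; apply: quotient_norm_le; exact: subspaceD.
have scale_le s x : 0 < s ->
    quotient_norm M ((s%:C)%C *: x) <= s * quotient_norm M x.
  move=> s0; rewrite mulrC -ler_pdivrMr //.
  apply: le_quotient_norm => // m Mm; rewrite ler_pdivrMr //.
  apply: le_trans (quotient_norm_le _ (subspaceZ (s%:C)%C Ms Mm)) _.
  by rewrite -scalerBr rnormZ rnorm_real gtr0_norm // mulrC.
move=> s x; rewrite le_eqVlt => /orP[/eqP <-|s0].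
  rewrite scale0r mul0r; apply/eqP; rewrite eq_le; apply/andP; split.
    by rewrite -[leRHS](rnorm0 X) -[X in rnorm X]subr0 quotient_norm_le //; exact: Ms.1.
  by apply: le_quotient_norm => // m _; exact: rnorm_ge0.
apply/eqP; rewrite eq_le scale_le //=.
have := scale_le s^-1 ((s%:C)%C *: x); rewrite invr_gt0 => /(_ s0).
by rewrite real_scaleA mulVf ?gt_eqF // scale1r mulrC -ler_pdivrMr ?invr_gt0 // invrK mulrC.
Qed.

Lemma quotient_norm_gt0 M y : closed_subspace M -> ~ M y -> 0 < quotient_norm M y.
Proof.
move=> [Ms Mc] My; rewrite ltNge; apply/negP => q0; apply: My.
apply: Mc; apply/closure_rnormP => e e0; apply: contrapT => h.
have : e <= quotient_norm M y.
  apply: le_quotient_norm => // m Mm; rewrite leNgt; apply/negP => me.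
  by apply: h; exists m.
by move=> /le_trans/(_ q0); rewrite leNgt e0.
Qed.

(** A real functional dominated by the distance to [M] vanishes on [M] and can be made to attain
    that distance at [y], which is positive. Complexifying it and dividing by the value at [y] gives
    [f]. The explicit bound [B] is kept for normalising rank one operators. *)
Lemma hahn_banach_separation M y : closed_subspace M -> ~ M y ->
  exists2 f, annihilator M f &
    f y = 1 /\ exists B : R, forall x, rnorm (f x : R[i]) <= B * rnorm x.
Proof.
move=> Mcl My; have [Ms Mc] := Mcl.
have [u [uD uZ ule uy]] := hahn_banach_sublinear y (sublinear_quotient_norm Ms).
have u_norm x : `|u x| <= rnorm x.
  have le z : u z <= rnorm z.
    by apply: le_trans (ule z) _; rewrite -[in leRHS](subr0 z) quotient_norm_le //; exact: Ms.1.
  rewrite ler_norml le andbT lerNl.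
  have := uZ (-1) x; rewrite rmorphN scaleN1r mulN1r => <-.
  by rewrite -(rnormN x) le.
have uM m : M m -> u m = 0.
  move=> Mm; have le0 z : M z -> u z <= 0.
    by move=> Mz; apply: le_trans (ule z) _; rewrite -[leRHS](rnorm0 X) -(subrr z) quotient_norm_le.
  apply/eqP; rewrite eq_le le0 //= -oppr_le0.
  have := uZ (-1) m; rewrite rmorphN scaleN1r mulN1r => <-.
  by apply: le0; rewrite -scaleN1r; exact: subspaceZ.
(* The usual complexification [g(x) = u(x) - i u(i x)]. *)
pose g x : R[i] := Complex (u x) (- u ('i%C *: x)).
have uCZ (a b : R) x : u (Complex a b *: x) = a * u x + b * u ('i%C *: x).
  rewrite -!uZ -uD scalerA -scalerDl; congr (u (_ *: x)).
  by apply/eqP; rewrite eq_complex /=; apply/andP; split; apply/eqP; ring.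
have glin (a : R[i]) x z : g (a *: x + z) = a * g x + g z.
  case: a => a b; rewrite /g scalerDr !uD scalerA.
  have -> : ('i * Complex a b)%C = Complex (- b) a.
    by apply/eqP; rewrite eq_complex /=; apply/andP; split; apply/eqP; ring.
  rewrite (uCZ a b) (uCZ (- b) a); apply/eqP; rewrite eq_complex /=.
  by apply/andP; split; apply/eqP; ring.
have gy : g y != 0.
  apply/eqP => /(congr1 (@complex.Re R)) /=; rewrite uy => /eqP.
  by rewrite gt_eqF // quotient_norm_gt0.
have gB x : rnorm (g x) <= 2 * rnorm x.
  have -> : g x = ((u x)%:C)%C + 'i%C * ((- u ('i%C *: x))%:C)%C.
    by apply/eqP; rewrite eq_complex /=; apply/andP; split; apply/eqP; ring.
  apply: le_trans (rnormD _ _) _.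
  have rni : rnorm ('i%C : R[i]) = 1 by rewrite /rnorm normc_def /= expr0n expr1n add0r sqrtr1.
  have := @rnormZ R R[i]^o 'i%C ((- u ('i%C *: x))%:C)%C.
  rewrite /GRing.scale /= => ->; rewrite rni mul1r !rnorm_real normrN.
  have := u_norm x; have := u_norm ('i%C *: x); rewrite rnormZ rni mul1r; lra.
exists (fun x => (g y)^-1 * g x).
  split; last first.
    move=> x Mx; rewrite (_ : g x = 0) ?mulr0 // /g !uM ?oppr0 //.
    exact: subspaceZ.
  split; first by move=> a x z; rewrite glin; ring.
  apply: (@lipschitz_continuous R X R[i]^o _ (rnorm (g y)^-1 * 2)) => x z.
  have -> : (g y)^-1 * g x - (g y)^-1 * g z = (g y)^-1 * g (x - z).
    by rewrite [x - z]addrC -[- z]scaleN1r glin; ring.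
  have := @rnormZ R R[i]^o (g y)^-1 (g (x - z)).
  rewrite {1}/GRing.scale /= => ->.
  by rewrite -mulrA ler_wpM2l ?rnorm_ge0.
split; first by rewrite mulVf.
exists (rnorm (g y)^-1 * 2) => x.
have := @rnormZ R R[i]^o (g y)^-1 (g x).
rewrite {1}/GRing.scale /= => ->.
by rewrite -mulrA ler_wpM2l ?rnorm_ge0.
Qed.

End Separation.

(** * Spans, one-dimensional extensions and flags modulo a subspace *)

Section Subspaces.
Variables (R : realType) (X : completeNormedModType R[i]).
Implicit Types (M K W S : set X) (x y z : X).

Lemma subspace_lin_span S : is_subspace (lin_span S).
Proof.
split.
  exists 0%N, (fun=> 0), (fun=> 0); split; first by case.
  by rewrite big_ord0.
move=> a _ _ [n [c [v [Sv ->]]]] [m [d [w [Sw ->]]]].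
exists (n + m)%N, (fun i : 'I_(n + m) => match fintype.split i with inl j => a * c j | inr j => d j end),
  (fun i : 'I_(n + m) => match fintype.split i with inl j => v j | inr j => w j end).
split; first by move=> i; case: (fintype.split i).
rewrite big_split_ord scaler_sumr /=; congr (_ + _); apply: eq_bigr => i _.
  by rewrite (unsplitK (inl i : 'I_n + 'I_m)%type) scalerA.
by rewrite (unsplitK (inr i : 'I_n + 'I_m)%type).
Qed.

Lemma subspace_closure M : is_subspace M -> is_subspace (closure M).
Proof.
move=> Ms; split; first exact/subset_closure/Ms.1.
move=> a x y /closure_rnormP clx /closure_rnormP cly.
apply/closure_rnormP => e e0.
have a0 : 0 < 1 + rnorm a by rewrite ltr_pwDl ?rnorm_ge0.
have [|x' Mx' xx'] := clx (e / 2 / (1 + rnorm a)); first by rewrite !divr_gt0.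
have [|y' My' yy'] := cly (e / 2); first by rewrite divr_gt0.
exists (a *: x' + y'); first exact: Ms.2.
rewrite opprD addrACA -scalerBr; apply: le_lt_trans (rnormD _ _) _.
rewrite [ltRHS](splitr e); apply: ler_ltD => //; rewrite rnormZ.
move: xx'; rewrite ltr_pdivlMr // => /ltW; apply: le_trans.
by rewrite mulrC ler_wpM2l ?rnorm_ge0 // lerDr.
Qed.

Lemma closed_subspace_cspan S : closed_subspace (cspan S).
Proof.
split; first exact/subspace_closure/subspace_lin_span.
exact: closed_closure.
Qed.

Lemma sub_cspan S : S `<=` cspan S.
Proof.
move=> x Sx; apply: subset_closure; exists 1%N, (fun=> 1), (fun=> x).
by split=> //; rewrite big_ord1 scale1r.
Qed.

Lemma cspan_sub S M : closed_subspace M -> S `<=` M -> cspan S `<=` M.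
Proof.
move=> [Ms Mc] SM; apply: subset_trans Mc; apply: closureS.
move=> _ [n [c [v [Sv ->]]]]; apply: subspace_sum => // i _.
by apply: subspaceZ => //; apply: SM.
Qed.

Definition add_line W x : set X := [set z | exists c : R[i], W (z - c *: x)].

Lemma sub_add_line W x : W `<=` add_line W x.
Proof. by move=> z Wz; exists 0; rewrite scale0r subr0. Qed.

Lemma mem_add_line W x : is_subspace W -> add_line W x x.
Proof. by move=> Ws; exists 1; rewrite scale1r subrr; exact: Ws.1. Qed.

Lemma subspace_add_line W x : is_subspace W -> is_subspace (add_line W x).
Proof.
move=> Ws; split; first by apply: sub_add_line; exact: Ws.1.
move=> a y z [c Wy] [d Wz]; exists (a * c + d).
have := Ws.2 a _ _ Wy Wz; congr W.
by rewrite scalerBr scalerDl scalerA opprD addrACA.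
Qed.

(* The linear projection z |-> z - f z *: y, with f a functional killing W and
   f y = 1, is continuous, and W + C y is the preimage of W under it. *)
Lemma closed_subspace_add_line W y : closed_subspace W -> closed_subspace (add_line W y).
Proof.
move=> Wcl; have [Ws Wc] := Wcl; split; first exact: subspace_add_line.
have [Wy|nWy] := pselect (W y).
  suff -> : add_line W y = W by [].
  apply/seteqP; split; last exact: sub_add_line.
  move=> z [c Wz]; rewrite -(subrK (c *: y) z).
  by apply: subspaceD => //; exact: subspaceZ.
have [f [[flin _] fW] [fy [B fB]]] := hahn_banach_separation Wcl nWy.
pose P z := z - f z *: y.
have -> : add_line W y = P @^-1` W.
  apply/seteqP; split=> z /=; last by exists (f z).
  move=> [c Wz]; have : f (z - c *: y) = 0 by exact: fW.
  by rewrite addrC -scaleNr flin fy mulr1 addrC => /eqP; rewrite subr_eq0 => /eqP fz; rewrite /P fz.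
apply: closed_comp => // z _.
apply: (@lipschitz_continuous _ _ _ P (1 + B * rnorm y)) => z1 z2.
have -> : P z1 - P z2 = (z1 - z2) - f (z1 - z2) *: y.
  have -> : f (z1 - z2) = f z1 - f z2.
    by rewrite [z1 - z2]addrC -[- z2]scaleN1r flin mulN1r addrC.
  by rewrite /P scalerBl !opprB addrACA [RHS]addrACA [in LHS](addrC (- (f z1 *: y))).
apply: le_trans (rnormD _ _) _; rewrite mulrDl mul1r lerD2l rnormN rnormZ.
by rewrite mulrAC ler_wpM2r ?rnorm_ge0.
Qed.

Lemma findim_quot_self K : is_subspace K -> findim_quot K K.
Proof.
move=> Ks; exists 0%N, (fun=> 0) => m Km; exists (fun=> 0).
by rewrite big_ord0 subr0.
Qed.

Lemma findim_quotS S S' K K' : S `<=` S' -> K' `<=` K ->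
  findim_quot S' K' -> findim_quot S K.
Proof.
move=> SS' KK' [n [v h]]; exists n, v => m /SS'/h[c Kc].
by exists c; apply: KK'.
Qed.

Lemma findim_quot_add_line W K x : findim_quot W K -> findim_quot (add_line W x) K.
Proof.
move=> [n [v h]]; exists n.+1, (fun i => oapp v x (unlift ord0 i)) => z [c /h[d Kd]].
exists (fun i => oapp d c (unlift ord0 i)).
rewrite big_ord_recl unlift_none /= opprD addrA.
by under eq_bigr do rewrite liftK /=.
Qed.

(** A subspace that is finite-dimensional modulo [K] cannot contain [S], so a vector of [S] outside
    it can always be adjoined; the extension is again finite-dimensional modulo [K]. *)
Lemma exists_flag S K : is_subspace K -> ~ findim_quot S K ->
  exists x : nat -> X, exists W : nat -> set X,
  [/\ W 0%N = K, (forall n, S (x n)), (forall n, ~ W n (x n)) &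
      forall n, W n.+1 = add_line (W n) (x n)].
Proof.
move=> Ks Sinf.
(* Choice needs a value for every set [W]; when [W] is not finite-dimensional modulo [K] the default
   is 0. *)
have ex (W : set X) : exists x, findim_quot W K -> S x /\ ~ W x.
  have [Wfin|] := pselect (findim_quot W K); last by exists 0.
  apply: contrapT => h; apply: Sinf; apply: findim_quotS Wfin => // x Sx.
  by apply: contrapT => Wx; apply: h; exists x.
have [g gP] := choice ex.
pose W := fix W n := if n is m.+1 then add_line (W m) (g (W m)) else K.
have Wfin n : findim_quot (W n) K.
  by elim: n => [|n IH] /=; [exact: findim_quot_self|exact: findim_quot_add_line].
exists (g \o W), W; split=> // n; by have [] := gP _ (Wfin n).
Qed.

Lemma flag_mono (W : nat -> set X) : (forall n, W n `<=` W n.+1) ->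
  forall m n, (m <= n)%N -> W m `<=` W n.
Proof.
move=> Wi m n; elim: n => [|n IH]; first by rewrite leqn0 => /eqP ->.
rewrite leq_eqVlt => /orP[/eqP -> //|mn].
by apply: subset_trans (Wi n); exact: IH.
Qed.

(* n + 1 vectors lying in an n-dimensional space modulo K satisfy a nontrivial
   relation modulo K; its last nonzero coefficient contradicts x_n \notin W_n. *)
Lemma flag_not_findim S K (x : nat -> X) (W : nat -> set X) :
  is_subspace K -> K `<=` W 0%N -> (forall n, is_subspace (W n)) ->
  (forall n, W n `<=` W n.+1) -> (forall n, W n.+1 (x n)) ->
  (forall n, ~ W n (x n)) -> (forall n, S (x n)) -> ~ findim_quot S K.
Proof.
move=> Ks KW0 Ws Wi Wx nWx Sx [n [v h]].
have [A AP] := choice (fun i => h _ (Sx i)).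
pose B : 'M[R[i]]_(n.+1, n) := \matrix_(i, j) A i j.
have [u u0 uB] : exists2 u : 'rV[R[i]]_n.+1, u != 0 & u *m B = 0.
  have : kermx B != 0.
    (* An [n+1] by [n] matrix has rank at most [n], so its left kernel is nonzero. *)
    by rewrite -mxrank_eq0 mxrank_ker subn_eq0 -ltnNge ltnS rank_leq_col.
  by move=> /rowV0Pn[u /sub_kermxP uB u0]; exists u.
have Ku : K (\sum_(i < n.+1) u 0 i *: x i).
  have -> : \sum_(i < n.+1) u 0 i *: x i =
      \sum_(i < n.+1) u 0 i *: (x i - \sum_(j < n) A i j *: v j).
    under [RHS]eq_bigr do rewrite scalerBr.
    rewrite sumrB; apply/esym/eqP; rewrite subr_eq -subr_eq0 opprD addrA subrr sub0r oppr_eq0.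
    under eq_bigr do rewrite scaler_sumr.
    rewrite exchange_big /= big1 // => j _.
    under eq_bigr do rewrite scalerA.
    rewrite -scaler_suml; have := congr1 (fun w : 'rV_n => w 0 j) uB.
    rewrite !mxE => uBj; rewrite (_ : \sum_(i < n.+1) u 0 i * A i j = 0) ?scale0r //.
    by rewrite -[RHS]uBj; apply: eq_bigr => i _; rewrite mxE.
  by apply: subspace_sum => // i _; apply: subspaceZ.
have [i0 ui0] : exists i, u 0 i != 0.
  apply: contrapT => hu; move/eqP: u0; apply; apply/rowP => i; rewrite mxE.
  by apply/eqP/negPn/negP => ui; apply: hu; exists i.
pose P := fun i : 'I_n.+1 => u 0 i != 0.
case: (@arg_maxnP _ i0 P (@nat_of_ord n.+1) ui0) => i Pi imax.
apply: (nWx i).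
have Wmono := flag_mono Wi.
have : W i (u 0 i *: x i).
  have : W i (\sum_(j < n.+1) u 0 j *: x j) by apply: (Wmono 0%N) => //; apply: KW0.
  rewrite (bigD1 i) //= => Wsum.
  (* Isolate the term of index [i]: by maximality later coefficients vanish, and earlier vectors
     already lie in [W i]. *)
  rewrite -[X in W i X](addrK (\sum_(j < n.+1 | j != i) u 0 j *: x j)).
  apply: subspaceB => //; apply: subspace_sum => // j ji.
  have [Pj|] := boolP (P j); last first.
    by rewrite negbK => /eqP ->; rewrite scale0r; exact: (Ws i).1.
  apply: subspaceZ => //; apply: (Wmono j.+1) => //.
  have jle : (j <= i)%N := imax _ Pj.
  by rewrite ltn_neqAle jle andbT; exact: ji.
move=> /(subspaceZ (u 0 i)^-1 (Ws i)).
by rewrite scalerA mulVf // scale1r.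
Qed.

End Subspaces.

(** * Absolutely convergent series of operators *)

Section OperatorSeries.
Variables (R : realType) (X : completeNormedModType R[i]).

Lemma geometric_tail (n m : nat) : (n <= m)%N ->
  \sum_(n <= k < m) (2^-1 : R) ^+ k <= 2 * 2^-1 ^+ n - 2 * 2^-1 ^+ m.
Proof.
move=> nm; rewrite -(subnKC nm); elim: (m - n)%N => [|d IH].
  by rewrite addn0 big_geq // subrr.
rewrite addnS big_nat_recr ?leq_addr //= exprS.
by move: IH; lra.
Qed.

Lemma half_expr_small (e C : R) : 0 < e -> exists n, C * 2^-1 ^+ n < e.
Proof.
move=> e0; have [C0|C0] := leP C 0.
  by exists 0%N; rewrite expr0 mulr1; exact: le_lt_trans e0.
have [n hn] : exists n : nat, C / e < n%:R.
  by exists (Num.bound (C / e)); apply: archi_boundP; rewrite divr_ge0 ?ltW.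
exists n; rewrite exprVn ltr_pdivrMr ?exprn_gt0 //.
rewrite -ltr_pdivrMl // mulrC; apply: lt_trans hn _.
by rewrite -natrX ltr_nat ltn_expl.
Qed.

Lemma rnorm_le_small (x : X) (C : R) : (forall e, 0 < e -> rnorm x <= C * e) -> x = 0.
Proof.
move=> h; apply: rnorm_eq0; apply/eqP; rewrite eq_le rnorm_ge0 andbT.
rewrite leNgt; apply/negP => x0.
have C0 : 0 < 1 + `|C| by rewrite ltr_pwDl.
have := h (rnorm x / (2 * (1 + `|C|))); rewrite divr_gt0 ?mulr_gt0 // => /(_ isT).
have e0 : 0 < rnorm x / (2 * (1 + `|C|)) by rewrite divr_gt0 ?mulr_gt0.
apply/negP; rewrite -ltNge.
apply: (@le_lt_trans _ _ ((1 + `|C|) * (rnorm x / (2 * (1 + `|C|))))).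
  apply: ler_wpM2r; first exact: ltW.
  apply: le_trans (ler_norm C) _.
  by rewrite lerDr.
rewrite [ltLHS](_ : _ = rnorm x / 2); first by rewrite ltr_pdivrMr //; move: x0; set r := rnorm x; lra.
by field; rewrite gt_eqF.
Qed.

(** The geometric tail makes the partial sums Cauchy at each point, and completeness gives a limit
    that inherits the tail bound. Linearity passes to the limit, and the bound at [n = 0] shows that
    [T] is Lipschitz with constant 2. *)
Lemma operator_series (g : nat -> X -> X) :
  (forall k (a : R[i]) x y, g k (a *: x + y) = a *: g k x + g k y) ->
  (forall k x, rnorm (g k x) <= 2^-1 ^+ k * rnorm x) ->
  exists2 T, bounded_op T &
    forall n x, rnorm (T x - \sum_(k < n) g k x) <= 2 * 2^-1 ^+ n * rnorm x.
Proof.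
move=> glin gB.
pose s n x := \sum_(k < n) g k x.
have s_tail n m x : (n <= m)%N ->
    rnorm (s n x - s m x) <= 2 * 2^-1 ^+ n * rnorm x.
  move=> nm; rewrite rnormB /s -!(big_mkord xpredT (fun k => g k x)).
  rewrite (@big_cat_nat _ _ _ n 0%N m) //=.  rewrite [X in rnorm X]addrC addKr.
  have h : rnorm (\sum_(n <= k < m) g k x) <= \sum_(n <= k < m) 2^-1 ^+ k * rnorm x.
    elim/big_ind2: _ => //; first by rewrite rnorm0.
    by move=> a b c d ab cd; apply: le_trans (rnormD _ _) _; apply: lerD.
  apply: le_trans h _; rewrite -mulr_suml ler_wpM2r ?rnorm_ge0 //.
  apply: le_trans (geometric_tail nm) _.
  by rewrite gerBl mulr_ge0 // exprn_ge0.
have ex x : exists t, forall n, rnorm (t - s n x) <= 2 * 2^-1 ^+ n * rnorm x.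
  have /cauchy_cvgP : cauchy ((s ^~ x) @ \oo).
    apply/cauchy_exP => _ /gt0_complexE[e e0 ->].
    have [n hn] := half_expr_small (2 * rnorm x) e0.
    exists (s n x); exists n => // m /= nm.
    rewrite -ball_normE /= rnormE ltcR; apply: le_lt_trans (s_tail _ _ _ nm) _.
    by rewrite mulrAC.
  move=> /cvg_ex[t /= st]; exists t => n.
  apply/ler_addgt0Pr => e e0.
  move/cvgrPdist_lt : st => /(_ (e%:C)%C); rewrite ltcR => /(_ e0)[N _ hN].
  have /= := hN (maxn n N) (leq_maxr _ _); rewrite rnormE ltcR => /ltW le1.
  have le2 := s_tail n (maxn n N) x (leq_maxl _ _).
  rewrite -(subrK (s (maxn n N) x) t) -addrA addrC.
  apply: le_trans (rnormD _ _) _; apply: lerD => //.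
  by rewrite rnormB.
have [T TP] := choice ex.
have Tlin (a : R[i]) x y : T (a *: x + y) = a *: T x + T y.
  apply/eqP; rewrite -subr_eq0; apply/eqP.
  (* The constant collects the truncation errors at [a *: x + y], [x] and [y]. *)
  apply: (@rnorm_le_small _ (2 * rnorm (a *: x + y) + (2 * rnorm a * rnorm x + 2 * rnorm y))) => e e0.
  have [n] := half_expr_small 1 e0; rewrite mul1r => hn.
  have -> : T (a *: x + y) - (a *: T x + T y) =
     (T (a *: x + y) - s n (a *: x + y)) - (a *: (T x - s n x) + (T y - s n y)).
    have -> : s n (a *: x + y) = a *: s n x + s n y.
      by rewrite /s scaler_sumr -big_split /=; apply: eq_bigr => k _; exact: glin.
    by rewrite scalerBr [a *: T x - _ + _]addrACA -opprD opprB addrA subrK.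
  have h1 := TP (a *: x + y) n; have h2 := TP x n; have h3 := TP y n.
  apply: le_trans (rnormD _ _) _; rewrite mulrDl; apply: lerD.
    apply: le_trans h1 _; rewrite mulrAC ler_wpM2l ?mulr_ge0 ?rnorm_ge0 //.
    exact: ltW.
  rewrite rnormN; apply: le_trans (rnormD _ _) _; rewrite mulrDl; apply: lerD.
    rewrite rnormZ; apply: (@le_trans _ _ (rnorm a * (2 * 2^-1 ^+ n * rnorm x))).
      by rewrite ler_wpM2l ?rnorm_ge0.
    rewrite [leLHS](_ : _ = 2 * rnorm a * rnorm x * 2^-1 ^+ n); last by ring.
    by rewrite ler_wpM2l ?mulr_ge0 ?rnorm_ge0 // ltW.
  apply: le_trans h3 _; rewrite mulrAC ler_wpM2l ?mulr_ge0 ?rnorm_ge0 //.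
  exact: ltW.
exists T; last by move=> n x; exact: TP.
split=> //.
apply: (@lipschitz_continuous _ _ _ T 2) => x y.
have -> : T x - T y = T (x - y).
  by rewrite [x - y]addrC -[- y]scaleN1r Tlin scaleN1r addrC.
by have := TP (x - y) 0%N; rewrite /s big_ord0 subr0 expr0 mulr1.
Qed.

End OperatorSeries.

(** * Nests, predecessors and gaps *)

Section Nests.
Variables (R : realType) (X : completeNormedModType R[i]).
Variable E : set (set X).
Hypothesis nestE : nest E.
Implicit Types (K L M N F : set X) (x y z : X).

Lemma nest_closed M : E M -> closed_subspace M.
Proof. by case: nestE => h _; exact: h. Qed.

Lemma nest_subspace M : E M -> is_subspace M.
Proof. by move=> /nest_closed[]. Qed.

Lemma nest_total M N : E M -> E N -> M `<=` N \/ N `<=` M.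
Proof. by case: nestE => _ [h _]; exact: h. Qed.

Lemma nest_cspan_bigcup (G : set (set X)) : G `<=` E -> E (cspan (\bigcup_(M in G) M)).
Proof. by case: nestE => _ [_ [_ [_ [_ h]]]]; exact: h. Qed.

Lemma sproper_nest M N : E M -> E N -> ~ N `<=` M -> sproper M N.
Proof.
move=> EM EN nNM; case: (nest_total EM EN) => // MN; split=> // MN'.
by apply: nNM; rewrite MN'.
Qed.

Lemma sproper_notsub M N : sproper M N -> ~ N `<=` M.
Proof. by move=> [MN nMN] NM; apply: nMN; apply/seteqP. Qed.

Lemma nest_Eminus M : E (Eminus E M).
Proof. by apply: nest_cspan_bigcup => F []. Qed.

Lemma Eminus_sub M : E M -> Eminus E M `<=` M.
Proof.
move=> EM; apply: cspan_sub; first exact: nest_closed.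
by move=> x [F [_ [FM _]] Fx]; exact: FM.
Qed.

Lemma sub_Eminus F M : E F -> sproper F M -> F `<=` Eminus E M.
Proof. by move=> EF FM x Fx; apply: sub_cspan; exists F. Qed.

Lemma Eminus_gapN M : E M -> ~ sproper (Eminus E M) M -> Eminus E M = M.
Proof.
move=> EM ngap; apply: contrapT => h; apply: ngap; split=> //.
exact: Eminus_sub.
Qed.

(** With [M = Psi(N)], these are the vectors allowed in the rank one generators of [M0] attached to
    [N]. The union is taken without closure, so that each vector comes with a single witness [L]. *)
Definition below M : set X :=
  \bigcup_(L in [set L | E L /\ sproper (Eminus E L) M]) L.

(** Otherwise [M] is properly contained in [L], hence contained in [L_-], against the assumption. *)
Lemma below_member_sub L M : E L -> E M -> sproper (Eminus E L) M -> L `<=` M.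
Proof.
move=> EL EM LM; case: (nest_total EL EM) => // ML.
have [->//|nML] := pselect (M = L).
by case: (sproper_notsub LM); exact: sub_Eminus.
Qed.

Lemma below_sub M : E M -> below M `<=` M.
Proof. by move=> EM x [L [EL LM] Lx]; exact: (below_member_sub EL EM LM). Qed.

Lemma sproper_sub_below L M : E L -> sproper L M -> L `<=` below M.
Proof.
move=> EL LM x Lx; exists L => //; split=> //; split.
  exact: subset_trans (Eminus_sub EL) LM.1.
by move=> LmM; apply: (sproper_notsub LM); rewrite -LmM; exact: Eminus_sub.
Qed.

(** If [M_-] differs from [M], then [M] itself is one of the subspaces in the union. Otherwise [M]
    is the join of its proper predecessors, each of which lies in [below M]. *)
Lemma below_generates M K : E M -> closed_subspace K -> below M `<=` K -> M `<=` K.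
Proof.
move=> EM Kcl MK; have [gap|ngap] := pselect (sproper (Eminus E M) M).
  by apply: subset_trans MK => x Mx; exists M.
rewrite -(Eminus_gapN EM ngap); apply: cspan_sub => // x [F [EF FM] Fx].
by apply: MK; exact: (sproper_sub_below EF FM).
Qed.

(** If nothing lay strictly between, every proper predecessor of [M] would lie in [K], and so would
    their join [M]. *)
Lemma between_gapN K M : E K -> E M -> sproper K M -> Eminus E M = M ->
  exists L, [/\ E L, sproper K L & sproper L M].
Proof.
move=> EK EM KM MM; apply: contrapT => h; apply: (sproper_notsub KM).
rewrite -MM; apply: cspan_sub; first exact: nest_closed.
move=> x [F [EF FM] Fx]; apply: contrapT => Kx; apply: h; exists F; split=> //.
by apply: sproper_nest => // FK; apply: Kx; exact: FK.
Qed.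

Hypothesis pinfE : p_infty E.

(* If M_- is properly contained in M this is the p_infty-property; otherwise an
   infinite strictly increasing chain of the nest lies between K and M. *)
Lemma below_not_findim K M : E K -> E M -> sproper K M -> ~ findim_quot (below M) K.
Proof.
move=> EK EM KM; have [gap|ngap] := pselect (sproper (Eminus E M) M).
  move=> fin; apply: (pinfE EM gap); apply: findim_quotS fin.
    by move=> x Mx; exists M.
  exact: sub_Eminus.
have MM := Eminus_gapN EM ngap.
(* The hypotheses on [F] stand under the existential so that choice yields a total function; [set0]
   is a dummy value. *)
have ex F : exists L, E F -> sproper F M -> [/\ E L, sproper F L & sproper L M].
  have [[EF FM]|h] := pselect (E F /\ sproper F M).
    by have [L hL] := between_gapN EF EM FM MM; exists L.
  by exists set0 => EF FM; case: h.
have [g gP] := choice ex.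
pose W n := iter n g K.
have WP n : E (W n) /\ sproper (W n) M.
  by elim: n => [|n [EW WM]] //=; have [] := gP _ EW WM.
have Wstep n : sproper (W n) (W n.+1).
  by have [EW WM] := WP n; have [] := gP _ EW WM.
have exx n : exists x, W n.+1 x /\ ~ W n x.
  apply: contrapT => h; apply: (sproper_notsub (Wstep n)) => x Wx.
  by apply: contrapT => nWx; apply: h; exists x.
have [x xP] := choice exx.
apply: (@flag_not_findim _ _ _ _ x W) => //.
- exact: nest_subspace.
- by move=> n; apply: nest_subspace; exact: (WP n).1.
- by move=> n; exact: (Wstep n).1.
- by move=> n; exact: (xP n).1.
- by move=> n; exact: (xP n).2.
- move=> n; have [EW WM] := WP n.+1.
  by apply: (sproper_sub_below EW WM); exact: (xP n).1.
Qed.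

(** * Support functions and the generation of [Psi_-] *)

Variable Psi : set X -> set X.
Hypothesis supp : support_function E Psi.
Hypothesis Psi0 : Psi [set 0] = [set 0].

Lemma nest_Psi M : E M -> E (Psi M).
Proof. exact: supp.1. Qed.

Lemma nest_Psi_minus N : E N -> E (Psi_minus E Psi N).
Proof.
move=> EN; rewrite /Psi_minus; case: asboolP => _; first exact: nest_Psi.
case: asboolP => _; first exact: nest_Psi.
rewrite -(bigcup_image _ Psi id); apply: nest_cspan_bigcup => _ [F [EF _] <-].
exact: nest_Psi.
Qed.

(** If [N] is not inside [F_-], then [F] lies in [N], since a larger [F] would have [N] inside
    [F_-]. When [N_- = N], equality [F = N] is also excluded, so [Psi F] is one of the subspaces in
    the join defining [Psi_-(N)]. *)
Lemma Psi_sub_Psi_minus N F : E N -> E F -> ~ N `<=` Eminus E F ->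
  Psi F `<=` Psi_minus E Psi N.
Proof.
move=> EN EF nNF.
have FN : F `<=` N.
  have [-> //|nFN] := pselect (F = N).
  case: (nest_total EF EN) => // NF; case: nNF; apply: sub_Eminus => //.
  by split=> // NF'; apply: nFN.
rewrite /Psi_minus; case: asboolP => _; first exact: supp.2.
case: asboolP => [_|ngap]; first exact: supp.2.
move=> x Fx; apply: sub_cspan; exists F => //; split=> //; split=> // FN'.
by apply: nNF; rewrite FN' (Eminus_gapN EN ngap).
Qed.

(** The subspaces [Psi F] with [F] inside [N] and [N] not inside [F_-] generate [Psi_-(N)]: at a gap
    [F = N] suffices, otherwise every [F] properly inside [N] qualifies. At [N = {0}] the assumption
    [Psi({0}) = {0}] is what makes the claim true. *)
Lemma Psi_minus_sub N K : E N -> closed_subspace K ->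
  (forall F, E F -> F `<=` N -> ~ N `<=` Eminus E F -> Psi F `<=` K) ->
  Psi_minus E Psi N `<=` K.
Proof.
move=> EN Kcl h; rewrite /Psi_minus; case: asboolP => [->|_].
  by rewrite Psi0 => _ ->; exact: Kcl.1.1.
case: asboolP => [gap|_]; first by apply: h => //; exact: sproper_notsub.
apply: cspan_sub => // x [F [EF FN] Fx]; apply: (h F) => //; first exact: FN.1.
by move=> NF; apply: (sproper_notsub FN); exact: subset_trans (Eminus_sub EF).
Qed.

(** * Upper bound: operators of [M0] map [N] into [Psi_-(N)] *)

Lemma M0_gen_sub T N y : M0_gen E Psi T -> E N -> N y -> Psi_minus E Psi N (T y).
Proof.
move=> [n [c [f [x [L [N' [h ->]]]]]]] EN Ny.
have Ks := nest_subspace (nest_Psi_minus EN).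
apply: subspace_sum => // i _; have [EL EN' LN' [_ fN'] Lx] := h i.
apply: subspaceZ => //; rewrite /rank_one.
have [NN'|nNN'] := pselect (N `<=` Eminus E (N' i)).
  by rewrite fN' ?scale0r; [exact: Ks.1|exact: NN'].
apply: subspaceZ => //; apply: (Psi_sub_Psi_minus EN EN' nNN').
exact: (below_member_sub EL (nest_Psi EN') LN').
Qed.

Lemma M0_sub T N y : M0 E Psi T -> E N -> N y -> Psi_minus E Psi N (T y).
Proof.
move=> [_ h] EN Ny; have [_ Kc] := nest_closed (nest_Psi_minus EN).
apply: Kc; apply/closure_rnormP => e e0.
(* The operator tolerance [e / (1 + |y|)] gives an error below [e] at [y], also when [y = 0]. *)
have y0 : 0 < 1 + rnorm y by rewrite ltr_pwDl ?rnorm_ge0.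
have [|U UM hU] := h (e / (1 + rnorm y)); first by rewrite divr_gt0.
exists (U y); first exact: M0_gen_sub UM EN Ny.
have := hU y; rewrite !rnormE -rmorphM lecR => /le_lt_trans; apply.
rewrite mulrAC -mulrA gtr_pMr // ltr_pdivrMr // mul1r.
by rewrite ltrDr.
Qed.

Lemma M0_of_gen T : bounded_op T -> M0_gen E Psi T -> M0 E Psi T.
Proof.
move=> bT gT; split=> // e e0; exists T => // y.
by rewrite subrr normr0 mulr_ge0 // ler0c ltW.
Qed.

(** * Lower bound: rank one operators and operators with infinite-dimensional images *)

Lemma rank_one_bounded (f : X -> R[i]^o) x (B : R) : dual_elt f ->
  (forall y, rnorm (f y : R[i]) <= B * rnorm y) -> bounded_op (rank_one f x).
Proof.
move=> [flin _] fB.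
have lin (a : R[i]) y z : rank_one f x (a *: y + z) = a *: rank_one f x y + rank_one f x z.
  by rewrite /rank_one flin scalerDl scalerA.
split=> //; apply: (@lipschitz_continuous _ _ _ _ (B * rnorm x)) => y z.
have -> : rank_one f x y - rank_one f x z = rank_one f x (y - z).
  by rewrite [y - z]addrC -[- z]scaleN1r lin scaleN1r addrC.
by rewrite /rank_one rnormZ mulrAC ler_wpM2r ?rnorm_ge0.
Qed.

Lemma M0_gen_rank_one F (f : X -> R[i]^o) x : E F -> annihilator (Eminus E F) f ->
  below (Psi F) x -> M0_gen E Psi (rank_one f x).
Proof.
move=> EF fF [L [EL LF] Lx].
exists 1%N, (fun=> 1), (fun=> f), (fun=> x), (fun=> L), (fun=> F); split=> //.
by apply/funext => y; rewrite big_ord1 scale1r.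
Qed.

Lemma Psi_sub_Phi N F : E N -> E F -> ~ N `<=` Eminus E F ->
  Psi F `<=` Phi (M0 E Psi) N.
Proof.
move=> EN EF nNF; apply: below_generates; first exact: nest_Psi.
  exact: closed_subspace_cspan.
move=> x Fx; have [y Ny nFy] : exists2 y, N y & ~ Eminus E F y.
  apply: contrapT => h; apply: nNF => y Ny; apply: contrapT => nFy.
  by apply: h; exists y.
have [f fF [fy [B fB]]] := hahn_banach_separation (nest_closed (nest_Eminus F)) nFy.
apply: sub_cspan; exists (rank_one f x), y; split; last first.
  by split=> //; rewrite /rank_one fy scale1r.
apply: M0_of_gen; last exact: M0_gen_rank_one EF fF Fx.
by apply: rank_one_bounded fB; exact: fF.1.
Qed.

(* T = \sum_k c_k f_k (x) x_k with f_k vanishing on F_- and y_0, ..., y_{k-1}: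
   then T y_k lies in c_k x_k + L + span (x_0, ..., x_{k-1}), which makes the
   images T y_k independent modulo L. *)
Lemma exists_M0_not_findim N F L : E N -> E F -> F `<=` N ->
  ~ N `<=` Eminus E F -> E L -> sproper L (Psi F) ->
  exists2 T, M0 E Psi T & ~ findim_quot (T @` N) L.
Proof.
move=> EN EF FN nNF EL LF.
have EFm := nest_Eminus F.
have Ninf : ~ findim_quot N (Eminus E F).
  move=> fin; apply: (below_not_findim EFm EN (sproper_nest EFm EN nNF)).
  by apply: findim_quotS fin => //; exact: below_sub.
have [y [V [V0 Ny nVy VS]]] := exists_flag (nest_subspace EFm) Ninf.
have [x [W [W0 Dx nWx WS]]] := exists_flag (nest_subspace EL)
  (below_not_findim EL (nest_Psi EF) LF).
have Vcl n : closed_subspace (V n).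
  elim: n => [|n IH]; first by rewrite V0; exact: nest_closed.
  by rewrite VS; exact: closed_subspace_add_line.
have Ws n : is_subspace (W n).
  elim: n => [|n IH]; first by rewrite W0; exact: nest_subspace.
  by rewrite WS; exact: subspace_add_line.
have Vmono := flag_mono (fun n => eq_ind_r (fun S => V n `<=` S) (@sub_add_line _ _ _ _) (VS n)).
have Wi n : W n `<=` W n.+1 by rewrite WS; exact: sub_add_line.
have Wmono := flag_mono Wi.
have exf k : exists fB : (X -> R[i]^o) * R, [/\ annihilator (V k) fB.1, fB.1 (y k) = 1 &
    forall z, rnorm (fB.1 z : R[i]) <= fB.2 * rnorm z].
  by have [f fV [fy [B fB]]] := hahn_banach_separation (Vcl k) (nVy k); exists (f, B).
have [fB fBP] := choice exf; pose f k := (fB k).1; pose B k := (fB k).2.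
have fF k : annihilator (Eminus E F) (f k).
  have [[fd fV] _ _] := fBP k; split=> // z Fz; apply: fV.
  by apply: (Vmono 0%N) => //; rewrite V0.
(* [d k] is positive and dominates the norm of the rank one operator built from [f k] and [x k];
   dividing by it gives [g k] norm at most [2^-k]. *)
pose d k : R := 1 + `|B k| * rnorm (x k).
have d0 k : 0 < d k by rewrite ltr_pwDl // mulr_ge0 // rnorm_ge0.
pose c k : R := 2^-1 ^+ k / d k.
have c0 k : 0 < c k by rewrite divr_gt0 // exprn_gt0.
pose g k z := ((c k)%:C)%C *: rank_one (f k) (x k) z.
have glin k (a : R[i]) z1 z2 : g k (a *: z1 + z2) = a *: g k z1 + g k z2.
  have [[[flin _] _] _ _] := fBP k.
  by rewrite /g /rank_one /f flin scalerDl scalerDr !scalerA mulrCA mulrA.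
have gB k z : rnorm (g k z) <= 2^-1 ^+ k * rnorm z.
  have [_ _ fb] := fBP k.
  rewrite /g !rnormZ rnorm_real gtr0_norm //.
  apply: (@le_trans _ _ (c k * (d k * rnorm z))); last first.
    by rewrite mulrA divfK // gt_eqF.
  rewrite ler_pM2l //.
  apply: (@le_trans _ _ (`|B k| * rnorm z * rnorm (x k))).
    rewrite ler_wpM2r ?rnorm_ge0 //; apply: le_trans (fb z) _.
    by rewrite ler_wpM2r ?rnorm_ge0 // ler_norm.
  by rewrite mulrAC ler_wpM2r ?rnorm_ge0 // lerDr.
have [T bT TP] := operator_series glin gB.
exists T.
  (* The truncations of the series are generators of [M0], and the tail bound gives convergence to
     [T] in operator norm. *)
  split=> // e e0; have [n hn] := half_expr_small 2 e0.
  exists (fun z => \sum_(k < n) g k z).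
    have hx k : exists L', [/\ E L', sproper (Eminus E L') (Psi F) & L' (x k)].
      by have [L' [EL' L'F] Lx] := Dx k; exists L'.
    have [L' L'P] := choice hx.
    exists n, (fun k => ((c k)%:C)%C), (fun k => f k), (fun k => x k), (fun k => L' k), (fun=> F).
    by split=> // i; have [] := L'P i.
  move=> z; rewrite !rnormE -rmorphM lecR; apply: le_trans (TP n z) _.
  by rewrite ler_wpM2r ?rnorm_ge0 // ltW.
have fy k j : (k < j)%N -> f j (y k) = 0.
  move=> kj; have [[_ fV] _ _] := fBP j; apply: fV.
  by apply: (Vmono k.+1) => //; rewrite VS; apply: mem_add_line; exact: (Vcl k).1.
(* All terms of index above [k] vanish at [y k], so the series is a finite sum there, with last term
   [c k] times [x k]. *)
have Ty k : T (y k) = \sum_(j < k) g j (y k) + ((c k)%:C)%C *: x k.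
  have sum_eq n : (k < n)%N ->
      \sum_(j < n) g j (y k) = \sum_(j < k) g j (y k) + ((c k)%:C)%C *: x k.
    elim: n => // n IH; rewrite ltnS leq_eqVlt => /orP[/eqP <-|kn].
      rewrite big_ord_recr /=; congr (_ + _).
      by have [_ fyk _] := fBP k; rewrite /g /rank_one /f fyk scale1r.
    by rewrite big_ord_recr /= IH // /g /rank_one fy // scale0r scaler0 addr0.
  apply/eqP; rewrite -subr_eq0; apply/eqP.
  apply: (@rnorm_le_small _ _ _ (2 * rnorm (y k))) => e e0.
  have [n] := half_expr_small 1 e0; rewrite mul1r => hn.
  rewrite -(sum_eq (maxn n k.+1)) ?leq_maxr //.
  apply: le_trans (TP _ _) _; rewrite mulrAC ler_wpM2l ?mulr_ge0 ?rnorm_ge0 //.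
  apply: le_trans (ltW hn); apply: ler_wiXn2l; rewrite ?leq_maxl //; lra.
have Wsum k : W k (\sum_(j < k) g j (y k)).
  apply: subspace_sum => // j _; apply: subspaceZ => //; apply: subspaceZ => //.
  by apply: (Wmono j.+1) => //; rewrite WS; exact: mem_add_line.
(* [T (y k)] lies in [W (k+1)] but not in [W k], because [c k] is nonzero and [x k] is outside
   [W k]. *)
apply: (@flag_not_findim _ _ _ _ (fun k => T (y k)) W) => //.
- exact: nest_subspace.
- by rewrite W0.
- move=> k; rewrite Ty; apply: subspaceD => //; first exact: Wi.
  by apply: subspaceZ => //; rewrite WS; exact: mem_add_line.
- move=> k; rewrite Ty => h; apply: (nWx k).
  have := subspaceB (Ws k) h (Wsum k); rewrite addrAC subrr add0r.
  move=> /(subspaceZ (((c k)%:C)%C)^-1 (Ws k)); rewrite scalerA mulVf ?scale1r //.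
  by rewrite gt_eqF // ltcR.
- by move=> k; exists (y k).
Qed.

(** * The support function and the essential support function *)

Lemma Phi_M0 N : E N -> Phi (M0 E Psi) N = Psi_minus E Psi N.
Proof.
move=> EN; apply/seteqP; split.
  apply: cspan_sub; first exact/nest_closed/nest_Psi_minus.
  by move=> _ [T [y [MT [Ny ->]]]]; exact: M0_sub.
apply: Psi_minus_sub => //; first exact: closed_subspace_cspan.
by move=> F EF _; exact: Psi_sub_Phi.
Qed.

(** [Psi_-(N)] is itself admissible in the meet, since it contains every [T N]. Conversely an
    admissible [L] must contain each generating [Psi F]: otherwise [L] is properly inside [Psi F],
    and some [T] in [M0] has [T N] infinite-dimensional modulo [L]. *)
Lemma Phi_e_M0 N : E N -> Phi_e E (M0 E Psi) N = Psi_minus E Psi N.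
Proof.
move=> EN; have EP := nest_Psi_minus EN; apply/seteqP; split.
  move=> x; apply; split=> // T MT.
  apply: findim_quotS (findim_quot_self (nest_subspace EP)) => //.
  by move=> _ [y Ny <-]; exact: M0_sub.
move=> x Px L [EL Lfin]; move: x Px.
apply: Psi_minus_sub => //; first exact: nest_closed.
move=> F EF FN nNF; apply: contrapT => nFL.
have [T MT] := exists_M0_not_findim EN EF FN nNF EL (sproper_nest EL (nest_Psi EF) nFL).
by apply; exact: Lfin.
Qed.

End Nests.

Theorem mainTheorem18 (R : realType) (X : completeNormedModType R[i])
  (E : set (set X)) (Psi : set X -> set X) :
  nest E -> p_infty E -> support_function E Psi -> Psi [set 0] = [set 0] ->
  forall N, E N ->
    Phi (M0 E Psi) N = Psi_minus E Psi N /\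
    Phi_e E (M0 E Psi) N = Psi_minus E Psi N.
Proof.
move=> nestE pinfE supp Psi0 N EN.
by split; [exact: Phi_M0|exact: Phi_e_M0].
Qed.
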